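(* Under the alternative hypothesis $\mathbb{H}_1$, for any small $\epsilon>0$ and for $\delta_2>0$, if $$\tau_s^{\ast}=\sqrt{2(1+\delta_2)\log(mn)}<\mu\sqrt{c^{L}_{\epsilon,n}},\qquad c^{L}_{\epsilon,n}=\left\lceil(1-\epsilon)\log_{1/p_1}|\mathcal{L}^0_n|\right\rceil,$$ then $$\mathbb{P}(X_s^{\ast}>\tau_s^{\ast}\ |\ \mathbb{H}_1)\rightarrow 1\quad\text{as } n\rightarrow\infty.$$
   Context: Fix positive integers $m$ (number of rows) and $C$; $n$ is the number of columns. Let $\mathcal{S}=\{(i,j):1\leq i\leq m,\ 1\leq j\leq n\}$, where $(i,j)$ is the node in row $i$ and column $j$, and let $X(i,j)$ be a random variable attached to each node. A chain with good continuation is a subset of $\mathcal{S}$ of the form $\mathcal{L}=\{(i_0,j),(i_1,j+1),\ldots,(i_L,j+L)\}$ with $L\ge 0$ and $|i_k-i_{k-1}|\leq C$ for $1\leq k\leq L$; its length is $|\mathcal{L}|=L+1$. Let $\mathcal{F}_n$ be the set of all chains with good continuation in $\mathcal{S}$. Alternative hypothesis $\mathbb{H}_1$: for some $\mu>0$ and some (unknown) chain $\mathcal{L}^0_n\in\mathcal{F}_n$, the $X(i,j)$ are independent, with $X(i,j)\sim N(\mu,1)$ for $(i,j)\in\mathcal{L}^0_n$ and $X(i,j)\sim N(0,1)$ for $(i,j)\in\mathcal{S}\setminus\mathcal{L}^0_n$. It is assumed that $|\mathcal{L}^0_n|\to\infty$ as $n\to\infty$. Fix a threshold $x^{\ast}\in\mathbb{R}$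 and let $p_1=\mathbb{P}(N(\mu,1)>x^{\ast})$. A node $(i,j)$ is significant if $X(i,j)>x^{\ast}$; a chain is significant if all its nodes are significant. Let $\mathcal{E}_n\subset\mathcal{F}_n$ be the (random) set of all significant chains. For $\mathcal{L}\in\mathcal{F}_n$ put $X(\mathcal{L})=\sum_{(i,j)\in\mathcal{L}}X(i,j)/\sqrt{|\mathcal{L}|}$, and let $X_s^{\ast}=\max_{\mathcal{L}\in\mathcal{E}_n}X(\mathcal{L})$ (with $X_s^{\ast}=-\infty$ if $\mathcal{E}_n=\emptyset$). *)

(* Defs.v *)
From HB Require Import structures.
From mathcomp Require Import all_boot all_order all_algebra.
From mathcomp Require Import all_classical all_reals all_analysis.
Import Order.TTheory GRing.Theory Num.Theory.
Import numFieldNormedType.Exports.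

Set Implicit Arguments.
Unset Strict Implicit.
Unset Printing Implicit Defensive.

Local Open Scope ring_scope.

(* Rows and columns are numbered from 0; only differences of row (resp. column)
   indices matter. *)
Definition node (m n : nat) : finType := ('I_m * 'I_n)%type.

(* Only the values i 0, ..., i L of the row function matter. *)
Definition good_continuation (C m n : nat) (A : {set node m n}) : Prop :=
  exists (L j : nat) (i : nat -> 'I_m),
    [/\ (j + L < n)%N,
        forall k : nat, (k < L)%N -> (`|(i k.+1 : nat) - (i k : nat)| <= C)%N
      & A = [set s : node m n |
              [exists k : 'I_L.+1, (s.1 == i k) && (s.2 == j + k :> nat)%N]]%SET].

Definition chains (C m n : nat) : {set {set node m n}} :=
  [set A : {set node m n} | `[< good_continuation C A >]]%SET.

Section Statistics.
Variables (R : realType) (C m n : nat) (xstar : R) (x : node m n -> R).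

Definition significant_chains : {set {set node m n}} :=
  [set A in chains C m n | [forall s in A, xstar < x s]]%SET.

Definition chain_stat (A : {set node m n}) : R :=
  \sum_(s in A) x s / Num.sqrt (#|A|%:R).

Definition max_significant_stat : \bar R :=
  \big[maxe/-oo%E]_(A in significant_chains) (chain_stat A)%:E.

End Statistics.

Section Alternative.
Context (d : measure_display) (T : measurableType d) (R : realType).
Variable P : probability T R.

Definition mutually_independent (I : finType) (X : I -> {RV P >-> R}) : Prop :=
  forall (J : {set I}) (B : I -> set R),
    (forall i, measurable (B i)) ->
    P (\bigcap_(i in [set` J]) X i @^-1` B i)%classic =
    (\prod_(i in J) P (X i @^-1` B i)%classic)%E.

Definition has_law (X : {RV P >-> R}) (Q : set R -> \bar R) : Prop :=
  forall B : set R, measurable B -> distribution P X B = Q B.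

(* The second argument of normal_prob is the standard deviation. *)
Definition alternative_hypothesis (m n : nat) (mu : R) (L0 : {set node m n})
    (X : node m n -> {RV P >-> R}) : Prop :=
  mutually_independent X /\
  forall s, has_law (X s) (normal_prob (if s \in L0 then mu else 0) 1).

End Alternative.

(* P (N(mu, 1) > xstar) *)
Definition significance_prob (R : realType) (mu xstar : R) : R :=
  fine (normal_prob mu 1 [set x : R | xstar < x]%classic).

Definition log_base (R : realType) (b y : R) : R := ln y / ln b.

Definition run_length (R : realType) (eps p1 : R) (l : nat) : int :=
  Num.ceil ((1 - eps) * log_base p1^-1 l%:R).

Definition threshold (R : realType) (delta : R) (m n : nat) : R :=
  Num.sqrt (2 * (1 + delta) * ln ((m * n)%N%:R)).

(* Main.v *)
Require Import Defs.
From HB Require Import structures.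
From mathcomp Require Import all_boot all_order all_algebra.
From mathcomp Require Import all_classical all_reals all_analysis.
From mathcomp Require Import measurable_realfun ring lra zify.
Import Order.TTheory GRing.Theory Num.Theory.
Import numFieldNormedType.Exports.

Set Implicit Arguments.
Unset Strict Implicit.
Unset Printing Implicit Defensive.

Local Open Scope classical_set_scope.
Local Open Scope ring_scope.

(** Write [l = #|L0 n|], [k = run_length], [p = P (N(mu, 1) > xstar)] and cut
the chain [L0 n] into [l %/ k] disjoint blocks of [k] consecutive nodes; each
block is itself a chain with good continuation. Call a block good if it is
significant and its values sum to at least [mu * k]. The standardized sum of a
good block is at least [mu * sqrt k], which exceeds the threshold, so it is
enough to show that some block is good with probability tending to 1.

A block is significant with probability [p ^ k], and it is good with
probability at least [p ^ k / 2] ([prob_good_block_ge]). Indeed, reflect about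
[mu] those coordinates of the block that lie strictly between [xstar] and
[2 * mu - xstar]. This preserves the law of the block and its significance,
and on a significant block [y + y' >= 2 * mu] for every coordinate [y] and its
image [y'], so that the block or its reflection has sum at least [mu * k].

The blocks are independent, hence none of them is good with probability at
most [(1 - p ^ k / 2) ^ (l %/ k)] ([prob_avoid_le]), which is at most
[expR (- (l %/ k) * p ^ k / 2)]. By the choice of [k], [p ^ k] is at least
[p * l ^ (eps - 1)] while [k] is of order [ln l], so that [(l %/ k) * p ^ k]
tends to infinity ([block_count_ge]).

The product rule for the coordinates is stated on rectangles, whereas being
good is not a rectangular event. The passage to arbitrary measurable events
rests on one uniqueness result, [eq_joint_law]: two families of random
variables, possibly on different probability spaces, with the same
probabilities of rectangles have the same joint law. Applied to a family and
its coordinatewise image it gives the invariance under reflection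
([joint_law_map]); applied to a family and to the family on the product of two
copies of the space that reads some coordinates from the first copy and the
others from the second, it gives the independence of events depending on
disjoint sets of coordinates ([independent_setI]). *)

(** * Reflection of the normal law *)

Section Reflection.
Context {R : realType}.
Implicit Types (mu a : R) (A B : set R).

Definition reflect_at mu (y : R) : R := 2 * mu - y.

Lemma measurable_reflect_at mu : measurable_fun setT (reflect_at mu).
Proof. exact: measurable_funB. Qed.

(** The preimage of an interval open at [a] and closed at [b] is the interval
closed at [2 * mu - b] and open at [2 * mu - a], of the same length. *)
Lemma lebesgue_measure_reflect mu A : measurable A ->
  pushforward lebesgue_measure (reflect_at mu : _ -> measurableTypeR R) A =
  lebesgue_measure A.
Proof.
move=> mA; apply/esym.
apply: (lebesgue_measure_unique (mu := pushforward lebesgue_measure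
   (reflect_at mu : measurableTypeR R -> measurableTypeR R))) => //.
  exact: measurable_reflect_at.
move=> mrefl _ [[a b]] _ <-.
have reflE : reflect_at mu @^-1` `]a, b]%classic =
    `[2 * mu - b, 2 * mu - a[%classic.
  apply/seteqP; split => x /=; rewrite !in_itv/= /reflect_at => /andP[? ?];
  by apply/andP; split; lra.
transitivity (lebesgue_measure (`[2 * mu - b, 2 * mu - a[%classic : set R)).
  rewrite !lebesgue_measure_itv/= !lte_fin ltrD2l ltrN2.
  by case: ifP => // _; rewrite -!EFinD; congr EFin; ring.
by rewrite /pushforward -reflE.
Qed.

Lemma normal_pdf_reflect mu x :
  normal_pdf mu 1 (reflect_at mu x) = normal_pdf mu 1 x.
Proof.
have h : (1 : R) != 0 by exact: oner_neq0.
rewrite (normal_pdfE _ h) /normal_fun /reflect_at.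
have -> : 2 * mu - x - mu = - (x - mu) by ring.
by rewrite sqrrN.
Qed.
Lemma normal_prob_reflect mu A : measurable A ->
  normal_prob mu 1 (reflect_at mu @^-1` A) = normal_prob mu 1 A.
Proof.
move=> mA; rewrite /normal_prob.
have mr : measurable_fun setT
  (reflect_at mu : measurableTypeR R -> measurableTypeR R).
  exact: measurable_reflect_at.
transitivity (\int[lebesgue_measure]_(x in reflect_at mu @^-1` A)
    ((fun y => (normal_pdf mu 1 y)%:E) \o
     (reflect_at mu : measurableTypeR R -> measurableTypeR R)) x)%E.
  by apply: eq_integral => x _; rewrite /comp normal_pdf_reflect.
rewrite -(ge0_integral_pushforward mr lebesgue_measure (D := A)); last 3 first.
- exact: mA.
- by apply/measurable_funTS/measurable_EFinP; exact: measurable_normal_pdf.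
- by move=> y _; rewrite lee_fin normal_pdf_ge0.
apply: eq_measure_integral => B mB _; exact: lebesgue_measure_reflect.
Qed.
End Reflection.

Section Flip.
Context {R : realType}.
Implicit Types (mu xstar y : R) (A : set R).

(** Reflection about [mu] of the points strictly between [xstar] and
[2 * mu - xstar], an interval symmetric about [mu] (and empty when
[mu <= xstar]); the other points are fixed. *)
Definition flip mu xstar y : R :=
  if (xstar < y) && (y < 2 * mu - xstar) then reflect_at mu y else y.

Lemma flip_preimage mu xstar A :
  flip mu xstar @^-1` A =
  reflect_at mu @^-1` (A `&` `]xstar, 2 * mu - xstar[) `|`
  A `\` `]xstar, 2 * mu - xstar[.
Proof.
have reflI y : (reflect_at mu y \in `]xstar, 2 * mu - xstar[) =
    (xstar < y) && (y < 2 * mu - xstar).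
  rewrite in_itv/= /reflect_at andbC ltrD2l ltrN2; congr (_ && _).
  by apply/idP/idP => ?; lra.
apply/seteqP; split => y; rewrite /preimage/= /flip reflI in_itv/=.
  by case: ifP => [h Ay|h Ay]; [left|right]; split.
by case: ifP => [h [[]//|[_ []]]|h [[]//|[]]].
Qed.

Lemma measurable_flip mu xstar : measurable_fun setT (flip mu xstar).
Proof.
move=> _ A mA; rewrite setTI flip_preimage; apply: measurableU.
  rewrite -[X in measurable X]setTI; apply: measurable_reflect_at => //.
  exact: measurableI.
exact: measurableD.
Qed.

Lemma normal_prob_flip mu xstar A : measurable A ->
  normal_prob mu 1 (flip mu xstar @^-1` A) = normal_prob mu 1 A.
Proof.
move=> mA; rewrite flip_preimage.
have mI : measurable (`]xstar, 2 * mu - xstar[%classic : set R) by [].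
have mAI := measurableI _ _ mA mI.
have mAD := measurableD mA mI.
rewrite measureU//; last 2 first.
- by rewrite -[X in measurable X]setTI; exact: measurable_reflect_at.
- apply/seteqP; split => y // -[[_ rI] [_ nI]]; apply: nI; move: rI.
  by rewrite /= !in_itv/= /reflect_at => /andP[? ?]; apply/andP; split; lra.
rewrite [RHS](measureDI (normal_prob mu 1) mA mI) addeC; congr (_ + _)%E.
exact: normal_prob_reflect.
Qed.
End Flip.


(** * Joint laws and independence *)

Section ConfigurationSpace.
Context {R : realType} {I : finType}.
Implicit Types (B : I -> set R) (J : {set I}).

(** The product of the [B i]. *)
Definition rect B : set (I -> R) := [set v | forall i, B i (v i)].

Definition rects : set (set (I -> R)) :=
  [set rect B | B in [set B | forall i, measurable (B i)]].

(** Configurations, with the sigma-algebra generated by the measurable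
rectangles. *)
Definition conf := g_sigma_algebraType rects.

Lemma rects_setI : setI_closed rects.
Proof.
move=> _ _ [B mB <-] [B' mB' <-].
exists (fun i => B i `&` B' i); first by move=> i; exact: measurableI.
apply/seteqP; split => v /=; first by move=> h; split => i; case: (h i).
by move=> [h h'] i; split.
Qed.

Lemma rects_setT : rects setT.
Proof. by exists (fun=> setT) => //; apply/seteqP; split. Qed.

Lemma measurable_coord (i : I) : measurable_fun setT (fun v : conf => v i).
Proof.
move=> _ A mA; apply: sub_sigma_algebra.
exists (fun j => if j == i then A else setT).
  by move=> j; case: ifP => // _; exact: measurableT.
apply/seteqP; split => v /=.
  by move=> /(_ i); rewrite eqxx; split.
by move=> [_ Av] j; case: eqP => // ->.
Qed.

Lemma measurable_conf d (T : measurableType d) (X : T -> I -> R) :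
  (forall i, measurable_fun setT (X^~ i)) ->
  measurable_fun setT (X : T -> conf).
Proof.
move=> mX; apply: (@measurability _ _ T conf setT X rects erefl) => _ [_ [B mB <-] <-].
have -> : setT `&` X @^-1` rect B =
    \bigcap_(i in [set: I]) (X^~ i) @^-1` B i.
  apply/seteqP; split => w /=; first by move=> [_ h] i _; exact: h.
  by move=> h; split => // i; exact: h.
apply: fin_bigcap_measurable => // i _.
by rewrite -[X in measurable X]setTI; exact: mX.
Qed.

(** Measurable rectangles are stable under intersection and generate the
sigma-algebra, so they determine the law. *)
Lemma eq_joint_law d d' (T : measurableType d) (T' : measurableType d')
    (P : probability T R) (P' : {measure set T' -> \bar R})
    (X : T -> I -> R) (X' : T' -> I -> R) :
  (forall i, measurable_fun setT (X^~ i)) ->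
  (forall i, measurable_fun setT (X'^~ i)) ->
  (forall B, (forall i, measurable (B i)) ->
    P (X @^-1` rect B) = P' (X' @^-1` rect B)) ->
  forall A : set conf, measurable A -> P (X @^-1` A) = P' (X' @^-1` A).
Proof.
move=> /measurable_conf mX /measurable_conf mX' XX' A mA.
apply: (measure_unique (T := conf) rects (fun=> setT) erefl rects_setI
  (fun=> rects_setT) _ (pushforward P (X : T -> conf))
  (pushforward P' (X' : T' -> conf)) _ _ A mA).
- by apply/seteqP; split => // v _; exists 0%N.
- by move=> _ [B mB <-]; exact: XX'.
- move=> _; rewrite -[X in (X < _)%E]/(P setT).
  by rewrite probability_setT ltry.
Qed.

(** Product rule over all the coordinates at once. The rule for a subfamily is
the case where the other [B i] are [setT]. *)
Definition independent_coords d (T : measurableType d) (P : probability T R)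
    (X : T -> I -> R) : Prop :=
  forall B, (forall i, measurable (B i)) ->
    P (X @^-1` rect B) = (\prod_i P ((X^~ i) @^-1` B i))%E.

(** Membership in [A] is determined by the coordinates in [J]. *)
Definition depends_on J (A : set conf) : Prop :=
  forall v v' : conf, {in J, v =1 v'} -> A v -> A v'.

Lemma measurable_avoid (G : nat -> set conf) (M : nat) :
  (forall b, measurable (G b)) ->
  measurable ([set v | forall b, (b < M)%N -> ~ G b v] : set conf).
Proof.
move=> mG.
have -> : [set v | forall b, (b < M)%N -> ~ G b v] =
    \bigcap_(b in [set b | (b < M)%N]) ~` G b by [].
by apply: bigcap_measurableType => b _; exact: measurableC.
Qed.

Section Independent.
Context d (T : measurableType d) (P : probability T R) (X : T -> I -> R).
Hypothesis mX : forall i, measurable_fun setT (X^~ i).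
Hypothesis indepX : independent_coords P X.

(** Changing each coordinate by a map that preserves its law does not change
the joint law. *)
Lemma joint_law_map (f : I -> R -> R) :
  (forall i, measurable_fun setT (f i)) ->
  (forall i (B : set R), measurable B ->
    P ((f i \o X^~ i) @^-1` B) = P ((X^~ i) @^-1` B)) ->
  forall A : set conf, measurable A ->
  P (X @^-1` A) = P ((fun w i => f i (X w i)) @^-1` A).
Proof.
move=> mf fX; apply: eq_joint_law => // [i|B mB].
  exact: (measurableT_comp (mf i) (mX i)).
rewrite (indepX mB).
have mfB i : measurable (f i @^-1` B i).
  by rewrite -[X in measurable X]setTI; exact: mf.
rewrite -[RHS]/(P (X @^-1` rect (fun i => f i @^-1` B i))) (indepX mfB).
by apply: eq_bigr => i _; rewrite -fX.
Qed.

(** Let [Y] on [T * T] read the coordinates in [J] from the first component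
and the others from the second one. It has the joint law of [X], and
[Y @^-1` (A `&` A')] is the product of [X @^-1` A] and [X @^-1` A']. *)
Lemma independent_setI J J' (A A' : set conf) :
  [disjoint J & J']%B -> depends_on J A -> depends_on J' A' ->
  measurable A -> measurable A' ->
  P (X @^-1` (A `&` A')) = (P (X @^-1` A) * P (X @^-1` A'))%E.
Proof.
move=> JJ' JA JA' mA mA'.
have mXA C : measurable C -> measurable (X @^-1` (C : set conf)).
  by move=> mC; rewrite -[X in measurable X]setTI; exact: measurable_conf.
pose Y (w : T * T) (i : I) := if i \in J then X w.1 i else X w.2 i.
have mY i : measurable_fun setT (Y^~ i).
  rewrite /Y; case: (i \in J).
    exact: (measurableT_comp (mX i) measurable_fst).
  exact: (measurableT_comp (mX i) measurable_snd).
have -> : P (X @^-1` (A `&` A')) = (P \x P)%E (Y @^-1` (A `&` A')).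
  apply: eq_joint_law => //; last exact: measurableI.
  move=> B mB.
  pose B1 i := if i \in J then B i else setT.
  pose B2 i := if i \in J then setT else B i.
  have mB1 i : measurable (B1 i) by rewrite /B1; case: ifP.
  have mB2 i : measurable (B2 i) by rewrite /B2; case: ifP.
  have mr C : (forall i, measurable (C i)) -> measurable (rect C : set conf).
    by move=> mC; apply: sub_sigma_algebra; exists C.
  have -> : Y @^-1` rect B = (X @^-1` rect B1) `*` (X @^-1` rect B2).
    apply/seteqP; split => -[w w'] /=.
      by move=> h; split => i; have := h i; rewrite /Y /B1 /B2; case: ifP.
    by move=> [h h'] i; have := h i; have := h' i; rewrite /Y /B1 /B2; case: ifP.
  transitivity (P (X @^-1` rect B1) * P (X @^-1` rect B2))%E; last first.
    by apply/esym; by apply: product_measure1E; apply: mXA; exact: mr.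
  rewrite (indepX mB) (indepX mB1) (indepX mB2) -big_split/=; apply: eq_bigr => i _.
  by rewrite /B1 /B2; case: ifP => _;
    rewrite preimage_setT probability_setT ?mule1 ?mul1e.
have -> : Y @^-1` (A `&` A') = (X @^-1` A) `*` (X @^-1` A').
  have YJ w : {in J, Y w =1 X w.1} by move=> i; rewrite /Y => ->.
  have YJ' w : {in J', Y w =1 X w.2}.
    move=> i iJ'; rewrite /Y ifF//; apply/negP => iJ.
    by move/pred0P: JJ' => /(_ i); rewrite /= iJ iJ'.
  apply/seteqP; split => w [Aw A'w]; split.
  - exact: JA (YJ w) Aw.
  - exact: JA' (YJ' w) A'w.
  - by apply: JA Aw => i /YJ ->.
  - by apply: JA' A'w => i /YJ' ->.
exact: (product_measure1E P P (mXA _ mA) (mXA _ mA')).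
Qed.

Lemma prob_avoid_le (D : nat -> {set I}) (G : nat -> set conf) (r : R) (M : nat) :
  (forall b c, b != c -> [disjoint D b & D c]%B) ->
  (forall b, depends_on (D b) (G b)) -> (forall b, measurable (G b)) ->
  r <= 1 -> (forall b, (b < M)%N -> (r%:E <= P (X @^-1` G b))%E) ->
  (P (X @^-1` [set v | forall b, (b < M)%N -> ~ G b v]) <= ((1 - r) ^+ M)%:E)%E.
Proof.
move=> disjD DG mG r1 rG.
pose bad k : set conf := [set v | forall b, (b < k)%N -> ~ G b v].
pose DD k : {set I} := (\bigcup_(b < k) D b)%SET.
have badS k : bad k.+1 = bad k `&` ~` G k.
  apply/seteqP; split => v /=.
    by move=> h; split => [b bk|]; apply: h => //; exact: ltnW.
  move=> [h h'] b; rewrite ltnS leq_eqVlt => /predU1P[->//|]; exact: h.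
have mbad k : measurable (bad k) by exact: measurable_avoid.
have depbad k : depends_on (DD k) (bad k).
  move=> v v' vv' h b bk Gv'; apply: (h b bk); apply: DG Gv' => i iD.
  by rewrite vv'//; apply/bigcupP; exists (Ordinal bk).
have dis k : [disjoint DD k & D k]%B.
  rewrite -setI_eq0 big_distrl/=; apply/eqP/big1 => b _.
  by apply/eqP; rewrite setI_eq0 disjD// neq_ltn ltn_ord.
have mXA C : measurable C -> measurable (X @^-1` (C : set conf)).
  by move=> mC; rewrite -[X in measurable X]setTI; exact: measurable_conf.
rewrite -/(bad M); elim: M rG => [|k IH] rG.
  by rewrite expr0 probability_le1//; exact: mXA.
rewrite badS (independent_setI (dis k)) //; last 2 first.
- by move=> v v' vv' nG /(DG _ v' v) h; apply: nG; apply: h => i /vv' ->.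
- exact: measurableC.
rewrite preimage_setC probability_setC; last exact: mXA.
rewrite exprSr EFinM lee_pmul//.
- rewrite -probability_setC; last exact: mXA.
  exact: measure_ge0.
- by apply: IH => b bk; apply: rG; exact: ltnW.
- by rewrite EFinB leeB// rG.
Qed.
End Independent.
End ConfigurationSpace.

(** * The number of blocks against the probability of significance *)

Section Counting.
Context {R : realType}.
Implicit Types (p eps : R) (k l : nat).

(** With [x = ln l], the hypothesis on [k] gives
[l * p ^ k >= expR (eps * x - ln p^-1) >= p * (eps * x) ^ 2 / 2] and
[k <= ((ln p^-1)^-1 + 1) * x], as [x >= 1]. Since [l %/ k] is greater than [l / k - 1], the
product [(l %/ k) * p ^ k] grows at least linearly in [x]. *)
Lemma block_count_ge p eps k l : 0 < p < 1 -> 0 < eps < 1 -> (0 < k)%N ->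
  1 <= ln (l%:R : R) ->
  k%:R < (1 - eps) * log_base p^-1 l%:R + 1 ->
  p * eps ^+ 2 / (2 * ((ln p^-1)^-1 + 1)) * ln l%:R - 1 <=
  (l %/ k)%:R * p ^+ k.
Proof.
move=> /andP[p0 p1] /andP[e0 e1] k0 x1; rewrite /log_base => kb.
set x : R := ln l%:R in x1 kb *; set lam := ln p^-1 in kb *.
have lam0 : 0 < lam by rewrite ln_gt0// invf_gt1.
have pE : expR (- lam) = p by rewrite /lam lnV ?posrE// opprK lnK ?posrE.
have l0 : 0 < l%:R :> R.
  rewrite ltNge; apply/negP => l0; have := ln_le0 (le_trans l0 ler01).
  by rewrite -/x leNgt (lt_le_trans _ x1).
have kR : 0 < k%:R :> R by rewrite ltr0n.
have x0 : 0 < x by lra.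
have k_le : k%:R <= (lam^-1 + 1) * x.
  have li : 0 < lam^-1 by rewrite invr_gt0.
  have : 0 <= eps * (x / lam) by rewrite mulr_ge0 ?mulr_ge0 ?ltW.
  have -> : (lam^-1 + 1) * x = x / lam + x by ring.
  by lra.
have klam : k%:R * lam <= (1 - eps) * x + lam.
  have -> : (1 - eps) * x + lam = ((1 - eps) * (x / lam) + 1) * lam.
    by field; rewrite gt_eqF.
  by rewrite ler_pM2r// ltW.
have ql : p * ((eps * x) ^+ 2 / 2) <= l%:R * p ^+ k.
  have -> : l%:R * p ^+ k = expR (x - k%:R * lam).
    by rewrite expRD /x lnK ?posrE// -mulrN [k%:R * _]mulrC expRM_natr pE.
  apply: (@le_trans _ _ (expR (- lam + eps * x))); last by rewrite ler_expR; lra.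
  rewrite expRD pE ler_pM2l//.
  have ex0 : 0 <= eps * x by rewrite mulr_ge0 ?ltW.
  by have := @expR_ge1Dxn R _ 1 ex0; rewrite (_ : 2`! = 2)%N//; lra.
have q0 : 0 <= p ^+ k by rewrite exprn_ge0 ?ltW.
have q1 : p ^+ k <= 1 by rewrite exprn_ile1 ?ltW.
have Mk : l%:R / k%:R - 1 <= (l %/ k)%:R :> R.
  rewrite lerBlDr ler_pdivrMr// natr1 -natrM ler_nat.
  by rewrite ltnW// -ltn_divLR.
apply: (@le_trans _ _ ((l%:R / k%:R - 1) * p ^+ k)); last by rewrite ler_wpM2r.
rewrite mulrBl mul1r; apply: lerB => //.
have -> : l%:R / k%:R * p ^+ k = (l%:R * p ^+ k) / k%:R by ring.
rewrite ler_pdivlMr//; apply: le_trans ql.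
set c := lam^-1 + 1 in k_le *.
have c0 : 0 < c by rewrite addr_gt0 ?invr_gt0.
have -> : p * ((eps * x) ^+ 2 / 2) = p * eps ^+ 2 / (2 * c) * x * (c * x).
  by field; rewrite gt_eqF.
by rewrite ler_wpM2l// !mulr_ge0 ?invr_ge0 ?mulr_ge0 ?exprn_ge0 ?ltW.
Qed.

(** The left-hand side is the probability that [M] independent trials of success
probability [p ^ k / 2] all fail. *)
Lemma failure_le p k (M : nat) :  0 <= p ^+ k <= 1 ->
  (1 - p ^+ k / 2) ^+ M <= expR (- (M%:R * p ^+ k / 2)).
Proof.
move=> /andP[? ?].
have -> : - (M%:R * p ^+ k / 2) = (- (p ^+ k / 2)) * M%:R by ring.
rewrite expRM_natr lerXn2r ?nnegrE ?expR_ge0//; first lra.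
exact: expR_ge1Dx.
Qed.
End Counting.

(** * Good blocks *)

Lemma measurable_sum_in {R : realType} {I : finType} (B : {set I}) d
    (T : measurableType d) (h : I -> T -> R) :
  (forall i, measurable_fun setT (h i)) ->
  measurable_fun setT (fun x => \sum_(i in B) h i x).
Proof.
move=> mh; rewrite (_ : (fun x => _) = (fun x => \sum_(i <- enum B) h i x)).
  exact: measurable_sum.
by apply/funext => x; rewrite big_enum.
Qed.

Section GoodBlock.
Context {R : realType} {I : finType} (mu xstar : R) (B : {set I}).

(** Configurations for which every node of [B] is significant. *)
Definition significant_block : set (conf (R := R) (I := I)) :=
  [set v | forall s, s \in B -> xstar < v s].

(** Configurations for which, moreover, the sum over [B] is at least
[mu * #|B|], its mean when the nodes of [B] have law N(mu, 1). *)
Definition good_block : set (conf (R := R) (I := I)) :=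
  [set v | (forall s, s \in B -> xstar < v s) /\
           mu * #|B|%:R <= \sum_(s in B) v s].

Lemma significant_blockE :
  significant_block =
  rect (fun s => if s \in B then `]xstar, +oo[%classic else setT).
Proof.
apply/seteqP; split => v /= h s.
  by case: ifPn => // /h; rewrite /= in_itv/= andbT.
by move=> sB; have := h s; rewrite sB /= in_itv/= andbT.
Qed.

Lemma measurable_significant_block : measurable significant_block.
Proof.
rewrite significant_blockE; apply: sub_sigma_algebra; eexists; last by [].
by move=> s /=; case: ifP.
Qed.

Lemma measurable_good_block : measurable good_block.
Proof.
have -> : good_block = significant_block `&`
    (fun v : conf => \sum_(s in B) v s) @^-1` `[mu * #|B|%:R, +oo[.
  by apply/seteqP; split => v /= -[h h']; split => //; move: h';
     rewrite /= in_itv/= andbT.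
apply: measurableI; first exact: measurable_significant_block.
rewrite -[X in measurable X]setTI.
suff : measurable_fun setT (fun v : conf => \sum_(s in B) v s : R) by apply.
exact: measurable_sum_in (fun s => measurable_coord s).
Qed.

Lemma good_block_depends : depends_on B good_block.
Proof.
move=> v v' vv' [h h']; split => [s sB|]; first by rewrite -vv' ?h.
by rewrite (eq_bigr v) // => s sB; rewrite vv'.
Qed.

Let flipB (s : I) : R -> R := if s \in B then flip mu xstar else id.

(** For a significant [B], the sum of the values and the sum of their images by
[flipB] add up to at least [2 * mu * #|B|], so one of the two is at least
[mu * #|B|]. *)
Lemma significant_block_cover :
  significant_block `<=`
  good_block `|` [set v | good_block (fun s => flipB s (v s))].
Proof.
move=> v sv.
have flip_gt s : s \in B -> xstar < flipB s (v s).
  move=> sB; rewrite /flipB sB /flip; have := sv s sB.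
  by case: ifP => //; rewrite /reflect_at => /andP[? ?] ?; lra.
have flip_ge s : s \in B -> 2 * mu <= v s + flipB s (v s).
  move=> sB; rewrite /flipB sB /flip /reflect_at; have := sv s sB => xv.
  by rewrite xv/=; case: ltP => ?; lra.
have sum2 : 2 * (mu * #|B|%:R) <= \sum_(s in B) v s + \sum_(s in B) flipB s (v s).
  rewrite -big_split/= mulrA mulr_natr -sumr_const; exact: ler_sum.
by have [h|h] := leP (mu * #|B|%:R) (\sum_(s in B) v s); [left|right];
  split => //=; lra.
Qed.

Context d (T : measurableType d) (P : probability T R) (X : T -> I -> R).
Hypothesis mX : forall i, measurable_fun setT (X^~ i).
Hypothesis indepX : independent_coords P X.
Hypothesis lawX : forall s, s \in B -> forall A : set R, measurable A ->
  P ((X^~ s) @^-1` A) = normal_prob mu 1 A.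

Lemma prob_significant_block :
  P (X @^-1` significant_block) = (significance_prob mu xstar ^+ #|B|)%:E.
Proof.
rewrite significant_blockE indepX; last by move=> s; case: ifP.
rewrite (bigID (mem B))/= [X in (_ * X)%E]big1 ?mule1; last first.
  by move=> s /negbTE ->; rewrite preimage_setT probability_setT.
rewrite (eq_bigr (fun=> (significance_prob mu xstar)%:E)); last first.
  move=> s sB; rewrite sB lawX// /significance_prob.
  have -> : [set x | xstar < x] = `]xstar, +oo[%classic.
    by apply/seteqP; split => x /=; rewrite in_itv/= andbT.
  by rewrite fineK// fin_num_measure.
by rewrite prodEFin prodr_const.
Qed.

Lemma prob_good_block_ge :
  ((significance_prob mu xstar ^+ #|B| / 2)%:E <= P (X @^-1` good_block))%E.
Proof.
have mXA C : measurable C -> measurable (X @^-1` (C : set conf)).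
  by move=> mC; rewrite -[X in measurable X]setTI; exact: measurable_conf.
have mflip s : measurable_fun setT (flipB s).
  by rewrite /flipB; case: ifP => _; [exact: measurable_flip|exact: measurable_id].
have mY i : measurable_fun setT (fun w => flipB i (X w i)).
  exact: (measurableT_comp (mflip i) (mX i)).
have flip_law := joint_law_map mX indepX mflip _ measurable_good_block.
have PG : P (X @^-1` good_block) =
    P (X @^-1` [set v | good_block (fun s => flipB s (v s))]).
  rewrite flip_law// => s A mA; rewrite /flipB; case: ifPn => // sB.
  have mfA : measurable (flip mu xstar @^-1` A).
    by rewrite -[X in measurable X]setTI; exact: measurable_flip.
  by rewrite -[LHS]/(P ((X^~ s) @^-1` (flip mu xstar @^-1` A))) !lawX//
    normal_prob_flip.
have mG := mXA _ measurable_good_block.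
have mfG : measurable (X @^-1` [set v | good_block (fun s => flipB s (v s))]).
  rewrite -[X in measurable X]setTI.
  exact: (measurable_conf mY measurableT measurable_good_block).
have : (P (X @^-1` significant_block) <=
    P (X @^-1` good_block) + P (X @^-1` good_block))%E.
  rewrite [X in (_ <= _ + X)%E]PG; apply: le_trans (measureU2 _ _ _) => //.
  apply: le_measure; rewrite ?inE.
  - by apply: mXA; exact: measurable_significant_block.
  - exact: measurableU.
  - by move=> w /significant_block_cover.
rewrite prob_significant_block.
have /fineK <- : P (X @^-1` good_block) \is a fin_num by exact: fin_num_measure.
by rewrite -EFinD !lee_fin; lra.
Qed.
End GoodBlock.

(** * Segments of a chain *)

Section Segments.
Context {m n : nat}.
Implicit Types (i : nat -> 'I_m) (j k l b : nat) (s : node m n).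

(** The nodes of row [i t] and column [j + t], for [t < l]. *)
Definition segment i j l : {set node m n} :=
  [set s : node m n |
    [exists t : 'I_l, (s.1 == i t) && (s.2 == j + t :> nat)%N]]%SET.

Lemma mem_segment i j l s :
  (s \in segment i j l) = [&& (j <= s.2)%N, (s.2 < j + l)%N & s.1 == i (s.2 - j)%N].
Proof.
rewrite inE; apply/existsP/and3P => [[t /andP[/eqP s1 /eqP s2]]|[js sl /eqP s1]].
  by rewrite s1 s2 leq_addr ltn_add2l ltn_ord addKn.
have tl : (s.2 - j < l)%N by rewrite ltn_subLR.
by exists (Ordinal tl); rewrite /= s1 subnKC// !eqxx.
Qed.

Lemma card_segment i j l : (j + l <= n)%N -> #|segment i j l| = l.
Proof.
move=> jln.
have jtn (t : 'I_l) : (j + t < n)%N.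
  by rewrite (leq_trans _ jln)// ltn_add2l.
pose f (t : 'I_l) : node m n := (i t, Ordinal (jtn t)).
have -> : segment i j l = (f @: [set: 'I_l])%SET.
  apply/setP => s; rewrite inE; apply/existsP/imsetP => [[t]|[t _ ->]].
    move=> /andP[/eqP s1 /eqP s2]; exists t => //.
    by rewrite [s]surjective_pairing s1; congr pair; exact/val_inj.
  by exists t; rewrite /= !eqxx.
rewrite card_imset ?cardsT ?card_ord// => t t' [_ /eqP].
by rewrite eqn_add2l => /eqP/val_inj.
Qed.

Lemma segment_chain C i j l : (0 < l)%N -> (j + l <= n)%N ->
  (forall t, (t.+1 < l)%N -> (`|(i t.+1 : nat) - (i t : nat)| <= C)%N) ->
  segment i j l \in chains C m n.
Proof.
case: l => // l _ jln gc; rewrite inE; apply/asboolP; exists l, j, i.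
by split; rewrite // -addnS.
Qed.

(** The [b]-th block of [k] consecutive nodes along the path [i] that starts at
column [j]. *)
Definition block i j k b : {set node m n} :=
  segment (fun t => i (b * k + t)%N) (j + b * k) k.

Lemma block_disjoint i j k b c : b != c ->
  [disjoint block i j k b & block i j k c]%B.
Proof.
move=> bc; apply/pred0P => s; apply/negbTE/negP => /= /andP[].
rewrite !mem_segment => /and3P[b1 b2 _] /and3P[c1 c2 _].
by move: bc; rewrite neq_ltn => /orP[] h; nia.
Qed.

Lemma block_sub i j k b l : (b < l %/ k)%N ->
  (block i j k b \subset segment i j l)%SET.
Proof.
move=> bl; have bkl : (b.+1 * k <= l)%N.
  by rewrite (leq_trans _ (leq_trunc_div l k))// leq_mul2r bl orbT.
apply/fintype.subsetP => s; rewrite !mem_segment => /and3P[b1 b2 /eqP ->].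
apply/and3P; split; [nia|nia|apply/eqP; congr i; lia].
Qed.
End Segments.

(** * Probability of detection *)

Lemma significance_prob_01 (R : realType) (mu xstar : R) :
  0 <= significance_prob mu xstar <= 1.
Proof.
have m : measurable [set x : R | xstar < x].
  rewrite (_ : [set x | _] = `]xstar, +oo[%classic)//.
  by apply/seteqP; split => x /=; rewrite in_itv/= andbT.
rewrite -!lee_fin /significance_prob fineK ?fin_num_measure//.
by rewrite measure_ge0 probability_le1.
Qed.

Section Detection.
Context {R : realType} {m n : nat} (C : nat) (mu xstar tau : R).
Context {d : measure_display} {T : measurableType d} {P : probability T R}.
Variable X : node m n -> {RV P >-> R}.

Let event : set T :=
  [set w | (tau%:E < max_significant_stat C xstar (fun s => X s w))%E].

Lemma eventE : event = [set w | exists2 A, A \in chains C m n &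
  (forall s, s \in A -> xstar < X s w) /\
  tau < chain_stat (fun s => X s w) A].
Proof.
apply/seteqP; split => w /=.
  move=> /bigmax_gtP[//|[A]].
  rewrite inE => /andP[AC /forall_inP sA]; rewrite lte_fin => tA.
  by exists A.
move=> [A AC [sA tA]]; apply/bigmax_gtP; right; exists A; last by rewrite lte_fin.
by rewrite inE AC; apply/forall_inP.
Qed.

Lemma measurable_event : measurable event.
Proof.
have mX s : measurable_fun setT (X s) by [].
have -> : event = \bigcup_(A in [set` chains C m n])
    ((fun w s => X s w) @^-1` significant_block xstar A `&`
     (fun w => chain_stat (fun s => X s w) A) @^-1` `]tau, +oo[).
  rewrite eventE; apply/seteqP; split => w /=.
    by move=> [A AC [sA tA]]; exists A => //; split => //=; rewrite in_itv/= tA.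
  by move=> [A AC [sA]]; rewrite /= in_itv/= andbT => tA; exists A.
apply: fin_bigcup_measurable; first exact: finite_finset.
move=> A _; apply: measurableI.
  rewrite -[X in measurable X]setTI.
  apply: (measurable_conf (X := fun w s => X s w)) => //.
  exact: measurable_significant_block.
rewrite -[X in measurable X]setTI.
suff : measurable_fun setT (fun w => chain_stat (fun s => X s w) A) by apply.
rewrite /chain_stat; apply: measurable_sum_in => s.
by apply: measurable_funM => //; exact: measurable_cst.
Qed.

(** The chain [L0] contains [#|L0| %/ k] disjoint blocks of length [k], and any
good one among them triggers the detection. *)
Lemma detection_prob_ge (L0 : {set node m n}) (k : nat) :
  alternative_hypothesis mu L0 X -> L0 \in chains C m n ->
  (0 < k)%N -> tau < mu * Num.sqrt k%:R ->
  ((1 - (1 - significance_prob mu xstar ^+ k / 2) ^+ (#|L0| %/ k))%:E <=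
   P event)%E.
Proof.
move=> [indX lawX] + k0 tauk.
rewrite inE => /asboolP[l' [j [i [jl gc L0E]]]].
have {}L0E : L0 = segment i j l'.+1 by [].
set l := l'.+1 in L0E; set p := significance_prob mu xstar.
have jln : (j + l <= n)%N by rewrite addnS.
have cL0 : #|L0| = l by rewrite L0E card_segment.
rewrite cL0; set M := (l %/ k)%N.
pose Y w s := X s w.
have mY s : measurable_fun setT (Y^~ s) by rewrite /Y.
have indY : independent_coords P Y.
  move=> B mB; have := indX [set: node m n]%SET B mB.
  rewrite (eq_bigl xpredT) => [<-|s]; last by rewrite inE.
  congr (P _); apply/seteqP; split => w /= h s; first by move=> _; exact: h.
  by apply: h; rewrite /= inE.
pose D b : {set node m n} := block i j k b.
have blk b : (b < M)%N -> (j + b * k + k <= n)%N.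
  move=> bM; have : (b.+1 * k <= l)%N.
    by rewrite (leq_trans _ (leq_trunc_div l k))// leq_mul2r bM orbT.
  by nia.
have cD b : (b < M)%N -> #|D b| = k by move=> bM; rewrite card_segment ?blk.
have /andP[p0 p1] : 0 <= p <= 1 by exact: significance_prob_01.
have pk1 : p ^+ k / 2 <= 1.
  by have := exprn_ile1 k p0 p1; lra.
have avoid := @prob_avoid_le _ _ _ _ _ _ mY indY D
  (fun b => good_block mu xstar (D b)) (p ^+ k / 2) M
  (@block_disjoint _ _ i j k) (fun b => @good_block_depends _ _ mu xstar (D b))
  (fun b => @measurable_good_block _ _ mu xstar (D b)) pk1.
have mev := measurable_event.
suff : (P (~` event) <= ((1 - p ^+ k / 2) ^+ M)%:E)%E.
  rewrite probability_setC//.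
  have /fineK <- : P event \is a fin_num by exact: fin_num_measure.
  by rewrite -EFinB !lee_fin; lra.
apply: le_trans (avoid _).
  apply: le_measure; rewrite ?inE; first exact: measurableC.
    rewrite -[X in measurable X]setTI; apply: (measurable_conf mY) => //.
    by apply: measurable_avoid => b; exact: measurable_good_block.
  move=> w nev b bM [sb sumb]; apply: nev; rewrite eventE; exists (D b).
    apply: segment_chain => //; first exact: blk.
    move=> t tk; rewrite addnS; apply: gc.
    have := blk b bM; have : (b.+1 * k <= l)%N.
      by rewrite (leq_trans _ (leq_trunc_div l k))// leq_mul2r bM orbT.
    by rewrite /l; nia.
  split => //; apply: lt_le_trans tauk _.
  have k0R : 0 < (k%:R : R) by rewrite ltr0n.
  rewrite /chain_stat -mulr_suml; move: sumb; rewrite (cD b bM) => sumb.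
  rewrite ler_pdivlMr ?sqrtr_gt0// -mulrA -expr2 sqr_sqrtr//.
move=> b bM; rewrite -(cD b bM); apply: prob_good_block_ge => // s sD A mA.
rewrite -[LHS]/(distribution P (X s) A) lawX//.
by rewrite L0E (fintype.subsetP (block_sub _ _ bM)).
Qed.
End Detection.

Theorem mainTheorem3 (R : realType) (m C : nat) (m_gt0 : (0 < m)%N)
    (C_gt0 : (0 < C)%N) (mu xstar eps delta2 : R) (mu_gt0 : 0 < mu)
    (eps_gt0 : 0 < eps) (eps_lt1 : eps < 1) (delta2_gt0 : 0 < delta2)
    (d : nat -> measure_display) (T : forall n : nat, measurableType (d n))
    (P : forall n : nat, probability (T n) R)
    (X : forall n : nat, node m n -> {RV (P n) >-> R})
    (L0 : forall n : nat, {set node m n})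
    (L0_chain : forall n : nat, (0 < n)%N -> L0 n \in chains C m n)
    (L0_length : #|L0 n| @[n --> \oo] --> \oo)
    (H1 : forall n : nat, (0 < n)%N -> alternative_hypothesis mu (L0 n) (X n))
    (threshold_lt : \forall n \near \oo,
       threshold delta2 m n <
       mu * Num.sqrt ((run_length eps (significance_prob mu xstar) #|L0 n|)%:~R)) :
  P n [set w | ((threshold delta2 m n)%:E <
                max_significant_stat C xstar (fun s => X n s w))%E]
    @[n --> \oo] --> 1%E.
Proof.
set p := significance_prob mu xstar in threshold_lt *.
pose x n : R := ln #|L0 n|%:R.
have x_large A : \forall n \near \oo, A <= x n.
  have [N AN] : exists N : nat, expR A <= N%:R.
    by exists (Num.truncn (expR A)).+1; rewrite ltW// truncnS_gt.
  have /cvgnyPge/(_ N) := L0_length; apply: filterS => n Nn.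
  have lN : expR A <= #|L0 n|%:R by rewrite (le_trans AN)// ler_nat.
  rewrite -[A]expRK /x ler_ln ?posrE ?expR_gt0//.
  exact: lt_le_trans (expR_gt0 _) lN.
have rl_gt0 : \forall n \near \oo, 0 < run_length eps p #|L0 n|.
  apply: filterS threshold_lt => n /(le_lt_trans (sqrtr_ge0 _)).
  by rewrite pmulr_rgt0// sqrtr_gt0 ltr0z.
(* If [p] is 0 or 1, the logarithm of [p^-1] is 0 because [0^-1 = 0] and
   [ln 0 = 0]; then [run_length] vanishes, against [rl_gt0]. *)
have p01 : 0 < p < 1.
  have [n] := filter_ex rl_gt0.
  rewrite /run_length ceil_gt0 /log_base => h.
  have /andP[p0 p1] := significance_prob_01 mu xstar; rewrite -/p in p0 p1.
  rewrite !lt_neqAle p0 p1 !andbT eq_sym; apply/andP; split; apply/eqP => pE.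
    by move: h; rewrite pE invr0 (ln0 (lexx 0)) invr0 !mulr0 ltxx.
  by move: h; rewrite pE invr1 ln1 invr0 !mulr0 ltxx.
have /andP[p0 p1] := p01.
pose c := p * eps ^+ 2 / (2 * ((ln p^-1)^-1 + 1)).
have c0 : 0 < c.
  have lam0 : 0 < ln p^-1 by rewrite ln_gt0// invf_gt1.
  by rewrite divr_gt0 ?mulr_gt0 ?exprn_gt0 ?addr_gt0 ?invr_gt0.
pose y n := (c * x n - 1) / 2.
have y_infty : y n @[n --> \oo] --> +oo.
  apply/cvgryPge => A; apply: filterS (x_large ((2 * A + 1) / c)) => n.
  by rewrite ler_pdivrMr// /y mulrC; lra.
apply: (@squeeze_cvge _ _ _ _ (fun n => (1 - expR (- y n))%:E) _ (cst 1%E)).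
- near=> n.
  have n0 : (0 < n)%N by near: n; exact: nbhs_infty_gt.
  have x1 : 1 <= x n by near: n; exact: x_large.
  have rl0 : 0 < run_length eps p #|L0 n| by near: n.
  have thr : threshold delta2 m n <
      mu * Num.sqrt (run_length eps p #|L0 n|)%:~R by near: n.
  rewrite probability_le1 ?andbT; last exact: measurable_event.
  pose k := `|run_length eps p #|L0 n| |%N.
  have kE : run_length eps p #|L0 n| = k%:Z by rewrite gtz0_abs.
  have k0 : (0 < k)%N by rewrite absz_gt0 gt_eqF.
  have k_lt : k%:R < (1 - eps) * log_base p^-1 #|L0 n|%:R + 1.
    have := ceilB1_lt ((1 - eps) * log_base p^-1 #|L0 n|%:R).
    by rewrite -/(run_length eps p #|L0 n|) kE intrB /= ltrBlDr.
  have tauk : threshold delta2 m n < mu * Num.sqrt k%:R.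
    by move: thr; rewrite kE.
  apply: (le_trans _ (detection_prob_ge xstar (H1 n n0) (L0_chain n n0) k0 tauk)).
  rewrite lee_fin lerD2l lerN2 -/p.
  have q01 : 0 <= p ^+ k <= 1 by rewrite exprn_ge0 ?exprn_ile1 ?ltW.
  apply: le_trans (failure_le _ q01) _; rewrite ler_expR lerN2 /y.
  rewrite ler_pM2r ?invr_gt0//.
  by apply: block_count_ge => //; rewrite eps_gt0.
- apply: cvg_EFin; first by apply: nearW.
  rewrite -[X in _ --> X]subr0; apply: cvgB; first exact: cvg_cst.
  apply: (@cvg_comp _ _ _ y (fun x => expR (- x)) _ _ _ y_infty).
  exact: cvgr_expR.
- exact: cvg_cst.
Unshelve. all: by end_near.
Qed.
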